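(* Let $\theta\in[0,1]$, $\Delta t>0$, and let $(u_h^n,q_h^n)\in V_h^k\times V_h^k$, $n\ge0$, satisfy the fully discrete DG scheme $$\Big(\frac{u_h^{n+1}-u_h^n}{\Delta t},\phi\Big)=-A(q_h^{n+\theta},\phi),\qquad (q_h^n,\psi)=A(u_h^n,\psi)\qquad\text{for all }\phi,\psi\in V_h^k,$$ where $v^{n+\theta}=(1-\theta)v^n+\theta v^{n+1}$. (1) If $\frac12\le\theta\le1$, the scheme is unconditionally $L^2$ stable; moreover, $$\|u_h^{n+1}\|^2\le\|u_h^n\|^2-2\Delta t\,\|(1-\theta)q_h^n+\theta q_h^{n+1}\|^2$$ holds for any $\Delta t>0$. (2) If $0\le\theta<\frac12$, the scheme is $L^2$ stable, i.e. $\|u_h^{n+1}\|\le\|u_h^n\|$, provided $$\Delta t<\frac{2h^4}{(1-2\theta)\gamma^2(k)},\qquad \gamma(k)=(k+1)^2k(k+2)+4(k+1)^2k\sqrt{k(k+2)} .$$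
   Context: The scheme approximates $u_t=-u_{xxxx}$ on $[a,b]$ with periodic boundary conditions. Mesh: $[a,b]$ is partitioned into cells $I_j=[x_{j-1/2},x_{j+1/2}]$, $j=1,\dots,N$, with $x_{1/2}=a$, $x_{N+1/2}=b$, $h_j=x_{j+1/2}-x_{j-1/2}$, $h=\max_{1\le j\le N}h_j$. $V_h^k=\{v\in L^2([a,b]): v|_{I_j}\in P^k(I_j),\ j=1,\dots,N\}$, where $P^k(I_j)$ is the set of polynomials of degree at most $k$ on $I_j$. At $x_{j+1/2}$: $v^\pm$ are the right/left one-sided limits, $\{v\}=(v^-+v^+)/2$, $[v]=v^+-v^-$. Periodicity convention: at $x_{N+1/2}$ one takes $v^+_{N+1/2}:=v^+_{1/2}$. $(\cdot,\cdot)$ and $\|\cdot\|$ are the $L^2([a,b])$ inner product and norm. The bilinear form is $$A(w,v)=\sum_{j=1}^N\int_{I_j}w_xv_x\,dx+\sum_{j=1}^N\big(\{w_x\}[v]+[w]\{v_x\}\big)_{j+1/2}.$$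
   Formalization: In part (2) the time-step bound uses h = min h_j instead of h = max h_j: with the maximum the claim fails on nonuniform meshes (e.g. θ=0, k=2, two cells of lengths 1 and 0.1); on uniform meshes the two coincide. *)

(* Defs.v *)
From HB Require Import structures.
From mathcomp Require Import all_boot all_order all_algebra.
From mathcomp Require Import all_classical all_reals all_analysis.

Set Implicit Arguments.
Unset Strict Implicit.
Unset Printing Implicit Defensive.

Import Order.TTheory GRing.Theory Num.Theory.
Import numFieldNormedType.Exports.

Local Open Scope classical_set_scope.
Local Open Scope ring_scope.

(* The node x_{j+1/2} is [x j], for j = 0, ..., N; values beyond N are unused.
   The cell I_{j+1} is therefore ]x j, x j.+1[ for j < N. *)
Definition is_mesh (R : realType) (a b : R) (N : nat) (x : nat -> R) : Prop :=
  [/\ x 0%N = a, x N = b & forall j : nat, (j < N)%N -> x j < x j.+1].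

(* Cells are taken open: piecewise polynomials are two-valued at the nodes, so
   nothing below may depend on the value of a function there. *)
Definition cell (R : realType) (x : nat -> R) (j : nat) : set R :=
  `]x j, x j.+1[%classic.

(* The length of the smallest cell. Every h_j is at most b - a, so this neutral
   element does not affect the minimum. On a uniform mesh it is also the
   length of the largest cell. The minimum is needed in the time-step
   restriction: if one cell shrinks while the largest is kept fixed, the
   spectral norm of [dg_form] on the piecewise polynomials of degree k >= 2
   grows like the inverse square of the smallest cell. *)
Definition hmin (R : realType) (a b : R) (N : nat) (x : nat -> R) : R :=
  \big[Num.min/(b - a)]_(j < N) (x j.+1 - x j).

(* Membership in L^2([a, b]) is automatic, since such a function agrees with a
   polynomial on each of finitely many bounded cells, up to finitely many
   points. *)
Definition Vh (R : realType) (N : nat) (x : nat -> R) (k : nat)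
    (v : R -> R) : Prop :=
  forall j : nat, (j < N)%N ->
    exists p : {poly R},
      (size p <= k.+1)%N /\ forall y : R, cell x j y -> v y = p.[y].

Definition inner (R : realType) (a b : R) (f g : R -> R) : R :=
  (\int[lebesgue_measure]_(y in `[a, b]) (f y * g y))%R.

Definition norm2 (R : realType) (a b : R) (f : R -> R) : R :=
  Num.sqrt (inner a b f f).

(* The traces, average and jump at x_{j+1/2}, for j = 1, ..., N; by periodicity
   the right trace at x_{N+1/2} is the one at x_{1/2}. *)
Definition trace_left (R : realType) (x : nat -> R) (v : R -> R) (j : nat) : R :=
  lim (v @ (x j)^'-).

Definition trace_right (R : realType) (N : nat) (x : nat -> R) (v : R -> R)
    (j : nat) : R :=
  lim (v @ (x (if j == N then 0%N else j))^'+).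

Definition average (R : realType) (N : nat) (x : nat -> R) (v : R -> R)
    (j : nat) : R :=
  (trace_left x v j + trace_right N x v j) / 2.

Definition jump (R : realType) (N : nat) (x : nat -> R) (v : R -> R)
    (j : nat) : R :=
  trace_right N x v j - trace_left x v j.

(* [derive1 w] is only ever evaluated inside the open cells, or in one-sided
   limits, which exclude the node itself: it is the broken derivative w_x. *)
Definition dg_form (R : realType) (N : nat) (x : nat -> R) (w v : R -> R) : R :=
  \sum_(j < N)
     (\int[lebesgue_measure]_(y in cell x j) (derive1 w y * derive1 v y))%R
  + \sum_(j < N)
     (average N x (derive1 w) j.+1 * jump N x v j.+1
      + jump N x w j.+1 * average N x (derive1 v) j.+1).

Definition theta_avg (R : realType) (theta : R) (v0 v1 : R -> R) : R -> R :=
  fun y => (1 - theta) * v0 y + theta * v1 y.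

Definition dg_scheme (R : realType) (a b : R) (N : nat) (x : nat -> R)
    (k : nat) (theta dt : R) (u q : nat -> R -> R) : Prop :=
  forall n : nat,
    [/\ Vh N x k (u n), Vh N x k (q n),
        forall phi : R -> R, Vh N x k phi ->
          inner a b (fun y => (u n.+1 y - u n y) / dt) phi
          = - dg_form N x (theta_avg theta (q n) (q n.+1)) phi
      & forall psi : R -> R, Vh N x k psi ->
          inner a b (q n) psi = dg_form N x (u n) psi].

Definition L2_stable (R : realType) (a b : R) (u : nat -> R -> R) : Prop :=
  forall n : nat, norm2 a b (u n.+1) <= norm2 a b (u n).

Definition dg_gamma (R : realType) (k : nat) : R :=
  (k%:R + 1) ^+ 2 * k%:R * (k%:R + 2)
  + 4 * (k%:R + 1) ^+ 2 * k%:R * Num.sqrt (k%:R * (k%:R + 2)).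
Arguments dg_gamma : clear implicits.

(* dt < 2 h^4 / ((1 - 2 theta) gamma(k)^2) for theta < 1/2, with the denominator
   cleared: for k = 0 it vanishes, the bound is +oo, and 2 h^4 / 0 would be 0
   in R. *)
Definition time_step_restriction (R : realType) (h theta dt : R) (k : nat)
    : Prop :=
  dt * ((1 - 2 * theta) * dg_gamma R k ^+ 2) < 2 * h ^+ 4.

(* Main.v *)
(* Testing the first equation with u^{n+theta} and the second with q^{n+theta},
   and using the symmetry of A, gives the energy identity
   |u^{n+1}|^2 - |u^n|^2 + (2 theta - 1) |D|^2 = - 2 dt |q^{n+theta}|^2,
   where D = u^{n+1} - u^n; this settles theta >= 1/2. For theta < 1/2, testing
   the first equation with D gives |D|^2 = - dt A(q^{n+theta}, D), so that
   |D| <= dt gamma(k) / h^2 |q^{n+theta}| by the continuity bound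
   |A(w, v)| <= gamma(k) / h^2 |w| |v|, and the extra term is absorbed.

   The continuity bound has exactly this constant as a consequence of two inverse
   inequalities on a cell of length h, for p of degree at most k:
   p(end)^2 <= (k+1)^2 / h |p|^2 and |p'|^2 <= k (k+1)^2 (k+2) / h^2 |p|^2.
   Both follow by induction on k after splitting off the component l of p
   orthogonal to lower degrees, a multiple of a Legendre polynomial, for which
   h l(end)^2 = (2k+1) |l|^2 and h^2 |l'|^2 = 2k(k+1)(2k+1) |l|^2. These two
   identities are derived from orthogonality alone. *)
Require Import Defs.
From HB Require Import structures.
From mathcomp Require Import all_boot all_order all_algebra.
From mathcomp Require Import all_classical all_reals all_analysis.
From mathcomp Require Import measurable_realfun.
From mathcomp Require Import ring lra.

Set Implicit Arguments.
Unset Strict Implicit.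
Unset Printing Implicit Defensive.

Import Order.TTheory GRing.Theory Num.Theory.
Import numFieldNormedType.Exports.

Local Open Scope ring_scope.

(** * Integration of polynomials *)

Definition antideriv (R : numFieldType) (p : {poly R}) : {poly R} :=
  \poly_(i < (size p).+1) (p`_i.-1 / i%:R).

(* At [i = 0] the junk value [x / 0 = 0] gives the vanishing constant term. *)
Lemma coef_antideriv (R : numFieldType) (p : {poly R}) (i : nat) :
  (antideriv p)`_i = p`_i.-1 / i%:R.
Proof.
rewrite coef_poly; case: ltnP => // hi.
by rewrite nth_default ?mul0r// -ltnS prednK// (leq_ltn_trans _ hi).
Qed.

Lemma antiderivK (R : numFieldType) (p : {poly R}) : (antideriv p)^`() = p.
Proof.
apply/polyP => i; rewrite coef_deriv coef_antideriv -[LHS]mulr_natr -mulrA.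
by rewrite mulVf ?mulr1 ?pnatr_eq0.
Qed.

Lemma antideriv_deriv (R : numFieldType) (p : {poly R}) :
  antideriv p^`() = p - (p`_0)%:P.
Proof.
apply/polyP => -[|i]; rewrite coef_antideriv coefB coefC/=.
  by rewrite invr0 mulr0 subrr.
by rewrite coef_deriv subr0 -(mulr_natr p`_i.+1) -mulrA mulfV ?mulr1 ?pnatr_eq0.
Qed.

(** An algebraic integral, so that linearity and integration by parts become polynomial identities;
    [Rintegral_horner] ties it to the Lebesgue integral, from which positivity is taken. *)
Definition pint (R : numFieldType) (c d : R) (p : {poly R}) : R :=
  (antideriv p).[d] - (antideriv p).[c].

Lemma pintD (R : numFieldType) (c d : R) (p q : {poly R}) :
  pint c d (p + q) = pint c d p + pint c d q.
Proof.
rewrite /pint; have -> : antideriv (p + q) = antideriv p + antideriv q.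
  by apply/polyP => i; rewrite coefD !coef_antideriv coefD mulrDl.
rewrite !hornerD; ring.
Qed.

Lemma pintZ (R : numFieldType) (c d t : R) (p : {poly R}) :
  pint c d (t *: p) = t * pint c d p.
Proof.
rewrite /pint; have -> : antideriv (t *: p) = t *: antideriv p.
  by apply/polyP => i; rewrite coefZ !coef_antideriv coefZ mulrA.
by rewrite !hornerZ mulrBr.
Qed.

Lemma pint0 (R : numFieldType) (c d : R) : pint c d (0 : {poly R}) = 0.
Proof. by rewrite -(scale0r (0 : {poly R})) pintZ mul0r. Qed.

Lemma pintB (R : numFieldType) (c d : R) (p q : {poly R}) :
  pint c d (p - q) = pint c d p - pint c d q.
Proof. by rewrite -scaleN1r pintD pintZ mulN1r. Qed.

Lemma pint_deriv (R : numFieldType) (c d : R) (p : {poly R}) :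
  pint c d p^`() = p.[d] - p.[c].
Proof. by rewrite /pint antideriv_deriv !hornerD !hornerN !hornerC; ring. Qed.

Lemma integrable_horner (R : realType) (c d : R) (p : {poly R}) :
  lebesgue_measure.-integrable `[c, d]%classic (EFin \o horner p).
Proof.
apply: continuous_compact_integrable; first exact: segment_compact.
by apply/continuous_subspaceT => y; exact: continuous_horner.
Qed.

Lemma Rintegral_horner (R : realType) (c d : R) (p : {poly R}) : c < d ->
  (\int[lebesgue_measure]_(y in `[c, d]) p.[y])%R = pint c d p.
Proof.
move=> cd; rewrite /Rintegral (@continuous_FTC2 _ _ (horner (antideriv p)))//.
- by apply/continuous_subspaceT => y; exact: continuous_horner.
- split=> [y _||]; first exact: derivable_horner.
  + by apply: cvg_at_right_filter; exact: continuous_horner.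
  + by apply: cvg_at_left_filter; exact: continuous_horner.
- by move=> y _; rewrite -derivE antiderivK.
Qed.

Lemma pint_sqr_ge0 (R : realType) (c d : R) (p : {poly R}) : c <= d ->
  0 <= pint c d (p * p).
Proof.
rewrite le_eqVlt => /predU1P[->|cd]; first by rewrite /pint subrr.
rewrite -Rintegral_horner//; apply: Rintegral_ge0 => y _.
by rewrite hornerM -expr2 sqr_ge0.
Qed.

Lemma poly_eq0_on_itv (R : realFieldType) (c d : R) (p : {poly R}) :
  c < d -> (forall y, c <= y <= d -> p.[y] = 0) -> p = 0.
Proof.
move=> cd p0; apply/eqP; apply: contraT => pn0.
(* These [size p] distinct points of the interval would all be roots of [p], one more than its
   degree allows. *)
pose s := [seq c + (d - c) / i.+1%:R | i <- iota 0 (size p)].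
have : (size s < size p)%N.
  apply: max_poly_roots => //.
    apply/allP => _ /mapP[i _ ->]; apply/rootP; apply: p0.
    have dc : 0 < d - c by rewrite subr_gt0.
    rewrite lerDl divr_ge0 ?(ltW dc)//= -lerBrDl ler_pdivrMr// ler_peMr ?(ltW dc)//.
    by rewrite ler1n.
  rewrite map_inj_uniq ?iota_uniq// => i j /addrI/mulfI.
  rewrite subr_eq0 gt_eqF// => /(_ isT)/invr_inj/eqP.
  by rewrite eqr_nat eqSS => /eqP.
by rewrite size_map size_iota ltnn.
Qed.

(** The antiderivative of p^2 is nondecreasing and takes equal values at c and d, so it is constant
    there and its derivative p^2 is the zero polynomial. *)
Lemma pint_sqr_eq0 (R : realType) (c d : R) (p : {poly R}) : c < d ->
  pint c d (p * p) = 0 -> p = 0.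
Proof.
move=> cd pp0; set P := antideriv (p * p).
have hP : P - P.[c]%:P = 0.
  apply: (poly_eq0_on_itv cd) => y /andP[cy yd].
  have := pint_sqr_ge0 p cy; have := pint_sqr_ge0 p yd.
  move: pp0; rewrite /pint -/P hornerD hornerN hornerC; lra.
have : (P - P.[c]%:P)^`() = p * p by rewrite derivB derivC subr0 antiderivK.
by rewrite hP deriv0 => /esym/eqP; rewrite mulf_eq0 orbb => /eqP.
Qed.

Lemma pint_cauchy_schwarz (R : realType) (c d : R) (p q : {poly R}) : c < d ->
  pint c d (p * q) ^+ 2 <= pint c d (p * p) * pint c d (q * q).
Proof.
move=> cd; set A := pint c d (p * p); set B := pint c d (q * q).
set C := pint c d (p * q).
have A0 : 0 <= A by apply: pint_sqr_ge0; exact: ltW.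
have : 0 <= B by apply: pint_sqr_ge0; exact: ltW.
rewrite le_eqVlt => /predU1P[/esym B0|B0].
  by rewrite /C (pint_sqr_eq0 cd B0) mulr0 pint0 expr0n/= mulr_ge0// B0.
(* This vector is B times the component of [p] orthogonal to [q]; its squared norm is B (A B -
   C^2). *)
have : 0 <= pint c d ((B *: p - C *: q) * (B *: p - C *: q)).
  by apply: pint_sqr_ge0; exact: ltW.
have -> : (B *: p - C *: q) * (B *: p - C *: q)
   = B ^+ 2 *: (p * p) - (2 * B * C) *: (p * q) + C ^+ 2 *: (q * q).
  rewrite -!mul_polyC !rmorphM/= ?rmorphXn/= rmorph_nat; ring.
rewrite pintD pintB !pintZ -/A -/B -/C.
have -> : B ^+ 2 * A - 2 * B * C * C + C ^+ 2 * B = B * (A * B - C ^+ 2) by ring.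
by rewrite pmulr_rge0// subr_ge0.
Qed.

(** * Inverse inequalities on an interval *)

(** Together with [size l <= n.+1], this describes the scalar multiples, zero included, of the
    degree n Legendre polynomial transported to [c, d]. *)
Definition poly_orth (R : numFieldType) (c d : R) (n : nat) (l : {poly R}) : Prop :=
  forall r : {poly R}, (size r <= n)%N -> pint c d (l * r) = 0.

(** Gram-Schmidt by induction on n: splitting ['X^n] yields a monic [l0] of degree n orthogonal to
    lower degrees, and the projection of [l] on [l0] is moved over to [q]. *)
Lemma poly_orth_split (R : realType) (c d : R) (n : nat) (p : {poly R}) : c < d ->
  exists q l, [/\ p = q + l, (size q <= n)%N & poly_orth c d n l].
Proof.
move=> cd; elim: n p => [|n IH] p.
  exists 0, p; rewrite add0r size_poly0; split=> // r.
  by rewrite leqn0 size_poly_eq0 => /eqP->; rewrite mulr0 pint0.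
have [q [l [-> sq ol]]] := IH p.
have [q0 [l0 [Xn sq0 ol0]]] := IH 'X^n.
have l0E : l0 = 'X^n - q0 by rewrite Xn addrC addKr.
have A0 : pint c d (l0 * l0) != 0.
  apply/eqP => /(pint_sqr_eq0 cd) /eqP; rewrite l0E subr_eq0 => /eqP h.
  by move: sq0; rewrite -h size_polyXn ltnn.
set t := pint c d (l * l0) / pint c d (l0 * l0).
exists (q + t *: l0), (l - t *: l0); split.
- by rewrite addrACA subrr addr0.
- rewrite (leq_trans (size_polyD _ _))// geq_max (leq_trans sq)//=.
  rewrite (leq_trans (size_scale_leq _ _))// l0E.
  rewrite (leq_trans (size_polyD _ _))// geq_max size_polyXn leqnn size_polyN.
  exact: leqW.
(* Since [l0] is monic of degree n, [e] has degree below n, and testing against [r] reduces to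
   testing against [e] and [l0]. *)
move=> r sr; set e := r - r`_n *: l0.
have se : (size e <= n)%N.
  apply/leq_sizeP => j nj; rewrite /e l0E coefB coefZ coefB coefXn.
  rewrite (nth_default _ (leq_trans sq0 nj)) subr0.
  case: eqVneq => [->|jn]; first by rewrite mulr1 subrr.
  by rewrite mulr0 subr0 nth_default// (leq_trans sr)// ltn_neqAle eq_sym jn.
have -> : r = e + r`_n *: l0 by rewrite /e subrK.
have -> : (l - t *: l0) * (e + r`_n *: l0) =
    l * e - t *: (l0 * e) + r`_n *: (l * l0 - t *: (l0 * l0)).
  by rewrite -!mul_polyC; ring.
rewrite pintD pintB !pintZ pintB !pintZ ol// ol0// divfK//.
by rewrite subrr !mulr0 subr0 addr0.
Qed.

(** By Euler's rule both terms have n times the coefficient of [l] in degree n, so the top degree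
    cancels. *)
Lemma size_XsubC_deriv (R : numFieldType) (e : R) (n : nat) (l : {poly R}) :
  (size l <= n.+1)%N -> (size (('X - e%:P) * l^`() - n%:R *: l)%R <= n)%N.
Proof.
move=> sl; apply/leq_sizeP => j nj.
have l0 : l`_j.+1 = 0 by rewrite nth_default// (leq_trans sl).
rewrite mulrBl !coefB coefXM coefCM !coef_deriv coefZ l0 mul0rn mulr0 subr0.
have -> : (if j == 0 then 0 else l`_(j.-1.+1) *+ j.-1.+1) = j%:R * l`_j.
  by case: j {nj l0} => [|j]/=; rewrite ?mul0r// mulr_natl.
rewrite -mulrBl; have [->|jn] := eqVneq j n; first by rewrite subrr mul0r.
by rewrite nth_default ?mulr0// (leq_trans sl)// ltn_neqAle eq_sym jn.
Qed.

(* Integrate [((X - e) l^2)' = l^2 + 2 (X - e) l' l] and use that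
   [(X - e) l' - n l] is of lower degree than [l], hence orthogonal to it. *)
Lemma orth_endpoint (R : realType) (c d e : R) (n : nat) (l : {poly R}) :
  (size l <= n.+1)%N -> poly_orth c d n l ->
  (d - e) * l.[d] ^+ 2 - (c - e) * l.[c] ^+ 2 = (2 * n%:R + 1) * pint c d (l * l).
Proof.
move=> sl ol; set s := ('X - e%:P) * l^`() - n%:R *: l.
have := pint_deriv c d (('X - e%:P) * (l * l)).
rewrite !hornerM !hornerXsubC -!expr2 => <-.
have -> : (('X - e%:P) * (l * l))^`() =
    (2 * n%:R + 1) *: (l * l) + 2 *: (l * s).
  rewrite /s !derivM derivB derivX derivC -!mul_polyC !rmorphD/= !rmorphM/=.
  by rewrite !rmorph_nat polyC1; ring.
by rewrite pintD !pintZ (ol s) ?mulr0 ?addr0//; exact: size_XsubC_deriv.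
Qed.

(** The Legendre operator is triangular on monomials: besides the eigenvalue j (j + 1), only
    coefficients of higher index enter. *)
Lemma coef_legendre_op (R : comNzRingType) (c d : R) (l : {poly R}) (j : nat) :
  ((('X - c%:P) * ('X - d%:P) * l^`())^`())`_j =
  j.+1%:R * (j%:R * l`_j - (c + d) * (j.+1%:R * l`_j.+1)
             + c * d * (j.+2%:R * l`_j.+2)).
Proof.
have -> : ('X - c%:P) * ('X - d%:P) * l^`() =
    'X * ('X * l^`()) - (c + d)%:P * ('X * l^`()) + (c * d)%:P * l^`().
  by rewrite polyCD polyCM; ring.
rewrite coef_deriv coefD coefB !coefCM !coefXM/= !coef_deriv.
by case: j => [|j]/=; ring.
Qed.

Lemma size_legendre_op (R : comNzRingType) (c d : R) (n : nat) (l : {poly R}) :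
  (size l <= n)%N -> (size ((('X - c%:P) * ('X - d%:P) * l^`())^`())%R <= n)%N.
Proof.
move=> sl; apply/leq_sizeP => j nj; have sj := leq_trans sl nj.
rewrite coef_legendre_op !nth_default ?(leqW (leqW sj)) ?(leqW sj)//.
by rewrite !mulr0 subr0 addr0 mulr0.
Qed.

(** Lagrange's identity: the difference is the integral of (W (p' q - p q'))', and the weight W
    vanishes at both ends. *)
Lemma legendre_op_sym (R : realType) (c d : R) (p q : {poly R}) :
  pint c d ((('X - c%:P) * ('X - d%:P) * p^`())^`() * q) =
  pint c d (p * (('X - c%:P) * ('X - d%:P) * q^`())^`()).
Proof.
set W := ('X - c%:P) * ('X - d%:P).
have := pint_deriv c d (W * (p^`() * q - p * q^`())).
rewrite !hornerM !hornerXsubC !subrr mulr0 !mul0r subr0 => h.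
apply/eqP; rewrite -subr_eq0 -pintB -h; apply/eqP; congr pint.
by rewrite !(derivM, derivB); ring.
Qed.

(* The difference of the two sides has lower degree than [l]; it is also
   orthogonal to lower degrees, the Legendre operator being symmetric. *)
Lemma orth_legendre (R : realType) (c d : R) (n : nat) (l : {poly R}) : c < d ->
  (size l <= n.+1)%N -> poly_orth c d n l ->
  (('X - c%:P) * ('X - d%:P) * l^`())^`() = (n%:R * (n%:R + 1)) *: l.
Proof.
move=> cd sl ol; set r := (X in X = _).
have ss : (size (r - (n%:R * (n%:R + 1)) *: l)%R <= n)%N.
  apply/leq_sizeP => j nj.
  have l1 : l`_j.+1 = 0 by rewrite nth_default// (leq_trans sl).
  have l2 : l`_j.+2 = 0 by rewrite nth_default// (leq_trans sl)// ltnW.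
  rewrite coefB coef_legendre_op coefZ l1 l2 !mulr0 subr0 addr0.
  have [->|jn] := eqVneq j n; first by rewrite -natr1; ring.
  by rewrite nth_default ?mulr0 ?subr0// (leq_trans sl)// ltn_neqAle eq_sym jn.
apply/eqP; rewrite -subr_eq0; apply/eqP; apply: (pint_sqr_eq0 cd).
rewrite [X in pint _ _ (X * _)]/= mulrBl pintB -scalerAl pintZ ol// mulr0 subr0.
by rewrite legendre_op_sym ol//; exact: size_legendre_op.
Qed.

(** Integration by parts leaves only boundary terms, as l'' is orthogonal to l. The Legendre
    equation at the ends turns l' into a multiple of l, and [orth_endpoint] evaluates l^2 there. *)
Lemma orth_deriv (R : realType) (c d : R) (n : nat) (l : {poly R}) : c < d ->
  (size l <= n.+1)%N -> poly_orth c d n l ->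
  (d - c) ^+ 2 * pint c d (l^`() * l^`()) =
  2 * n%:R * (n%:R + 1) * (2 * n%:R + 1) * pint c d (l * l).
Proof.
move=> cd sl ol; have h := orth_legendre cd sl ol.
have hd : (d - c) * l^`().[d] = n%:R * (n%:R + 1) * l.[d].
  move: (congr1 (horner^~ d) h); rewrite /= hornerZ => <-.
  by rewrite !(derivM, derivB, derivX, derivC) !hornerE; ring.
have hc : (d - c) * l^`().[c] = - (n%:R * (n%:R + 1) * l.[c]).
  move: (congr1 (horner^~ c) h); rewrite /= hornerZ => <-.
  by rewrite !(derivM, derivB, derivX, derivC) !hornerE; ring.
have sl2 : (size l^`()^`() <= n)%N.
  apply/leq_sizeP => j nj; rewrite !coef_deriv nth_default ?mul0rn//.
  by rewrite (leq_trans sl)// ltnW.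
have E : pint c d (l^`() * l^`()) = l.[d] * l^`().[d] - l.[c] * l^`().[c].
  have := pint_deriv c d (l * l^`()); rewrite !hornerM => <-.
  by rewrite derivM pintD (ol _ sl2) addr0.
have e1 := orth_endpoint c sl ol; have e2 := orth_endpoint d sl ol.
rewrite subrr mul0r subr0 in e1; rewrite subrr mul0r add0r -mulNr opprB in e2.
have -> : (d - c) ^+ 2 * pint c d (l^`() * l^`()) =
    (d - c) * (l.[d] * ((d - c) * l^`().[d]) - l.[c] * ((d - c) * l^`().[c])).
  by rewrite E; ring.
rewrite hd hc.
transitivity (n%:R * (n%:R + 1) *
    ((d - c) * l.[d] ^+ 2 + (d - c) * l.[c] ^+ 2)); first by ring.
by rewrite e1 e2; ring.
Qed.

(** Induction step shared by both inverse inequalities: the constants of two orthogonal components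
    add up. The cross term is handled by (al A)(be B) = (al B)(be A) and the arithmetic-geometric
    mean inequality. *)
Lemma cross_term_le (R : realFieldType) (e al be A B Q X L : R) :
  0 <= e -> 0 <= al -> 0 <= be -> 0 <= A -> 0 <= B ->
  0 <= Q -> 0 <= L ->
  e * Q <= al * A -> e * L <= be * B -> X ^+ 2 <= Q * L ->
  e * (Q + 2 * X + L) <= (al + be) * (A + B).
Proof.
move=> e0 al0 be0 A0 B0 Q0 L0 hQ hL hX.
have : 2 * (e * X) <= al * B + be * A.
  have h0 : 0 <= al * B + be * A by rewrite addr_ge0// mulr_ge0.
  apply: le_trans (ler_norm _) _; rewrite -ler_sqr ?nnegrE// real_normK ?num_real//.
  have h1 : (e * X) ^+ 2 <= (al * A) * (be * B).
    apply: (@le_trans _ _ ((e * Q) * (e * L))); last by apply: ler_pM => //; rewrite mulr_ge0.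
    by rewrite exprMn [leRHS]mulrACA -expr2 ler_wpM2l// sqr_ge0.
  have : 0 <= (al * B - be * A) ^+ 2 by exact: sqr_ge0.
  nra.
lra.
Qed.

(** The constant n^2 is the sum of the endpoint constants 2i + 1 over the degrees i < n. *)
Lemma poly_trace_ineq (R : realType) (c d : R) (n : nat) (p : {poly R}) : c < d ->
  (size p <= n)%N ->
  (d - c) * p.[d] ^+ 2 <= n%:R ^+ 2 * pint c d (p * p) /\
  (d - c) * p.[c] ^+ 2 <= n%:R ^+ 2 * pint c d (p * p).
Proof.
move=> cd; have dc : 0 <= d - c by rewrite subr_ge0 ltW.
elim: n p => [|n IH] p.
  rewrite leqn0 size_poly_eq0 => /eqP->.
  by rewrite mulr0 pint0 !horner0 expr0n/= !mulr0.
move=> sp; have [q [l [pE sq ol]]] := poly_orth_split n p cd.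
have sl : (size l <= n.+1)%N.
  have -> : l = p - q by rewrite pE addrC addKr.
  by rewrite (leq_trans (size_polyD _ _))// geq_max sp size_polyN leqW.
have [IH1 IH2] := IH q sq.
have e1 := orth_endpoint c sl ol; have e2 := orth_endpoint d sl ol.
rewrite subrr mul0r subr0 in e1; rewrite subrr mul0r add0r -mulNr opprB in e2.
have nE : n.+1%:R ^+ 2 = n%:R ^+ 2 + (2 * n%:R + 1) :> R by rewrite -natr1; ring.
have pp : pint c d (p * p) = pint c d (q * q) + pint c d (l * l).
  have -> : p * p = q * q + 2 *: (l * q) + l * l.
    by rewrite pE -mul_polyC rmorph_nat; ring.
  by rewrite !pintD pintZ ol// mulr0 addr0.
have n1 : 0 <= 2 * n%:R + 1 :> R by rewrite addr_ge0// mulr_ge0.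
have sq0 f : 0 <= pint c d (f * f) by apply: pint_sqr_ge0; exact: ltW.
rewrite nE pp pE !hornerD !sqrrD -!(mulr_natl (_ * _) 2).
split.
- by apply: cross_term_le; rewrite ?sqr_ge0 ?exprMn ?e1 ?sq0.
- by apply: cross_term_le; rewrite ?sqr_ge0 ?exprMn ?e2 ?sq0.
Qed.

(** The constant is the sum of the [orth_deriv] constants 2i (i + 1)(2i + 1) over i <= n. *)
Lemma poly_markov_L2 (R : realType) (c d : R) (n : nat) (p : {poly R}) : c < d ->
  (size p <= n.+1)%N ->
  (d - c) ^+ 2 * pint c d (p^`() * p^`()) <=
  (n%:R * (n%:R + 1) ^+ 2 * (n%:R + 2)) * pint c d (p * p).
Proof.
move=> cd; have dc : 0 <= d - c by rewrite subr_ge0 ltW.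
elim: n p => [|n IH] p sp.
  by rewrite (size1_polyC sp) derivC mul0r pint0 mulr0 !mul0r.
have [q [l [pE sq ol]]] := poly_orth_split n.+1 p cd.
have sl : (size l <= n.+2)%N.
  have -> : l = p - q by rewrite pE addrC addKr.
  by rewrite (leq_trans (size_polyD _ _))// geq_max sp size_polyN leqW.
have e1 := orth_deriv cd sl ol.
have pp : pint c d (p * p) = pint c d (q * q) + pint c d (l * l).
  have -> : p * p = q * q + 2 *: (l * q) + l * l.
    by rewrite pE -mul_polyC rmorph_nat; ring.
  by rewrite !pintD pintZ ol// mulr0 addr0.
have dd : pint c d (p^`() * p^`()) = pint c d (q^`() * q^`())
    + 2 * pint c d (q^`() * l^`()) + pint c d (l^`() * l^`()).
  rewrite -pintZ -!pintD; congr pint.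
  by rewrite pE derivD -mul_polyC rmorph_nat; ring.
have sq0 f : 0 <= pint c d (f * f) by apply: pint_sqr_ge0; exact: ltW.
set be := 2 * n.+1%:R * (n.+1%:R + 1) * (2 * n.+1%:R + 1) in e1.
have -> : n.+1%:R * (n.+1%:R + 1) ^+ 2 * (n.+1%:R + 2) =
    n%:R * (n%:R + 1) ^+ 2 * (n%:R + 2) + be by rewrite /be -natr1; ring.
have al0 : 0 <= n%:R * (n%:R + 1) ^+ 2 * (n%:R + 2) :> R.
  by rewrite mulr_ge0 ?addr_ge0// mulr_ge0// exprn_ge0 ?addr_ge0.
have be0 : 0 <= be by rewrite /be !mulr_ge0 ?addr_ge0 ?mulr_ge0.
rewrite pp dd; apply: cross_term_le => //.
- exact: sqr_ge0.
- exact: IH.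
- by rewrite e1.
- exact: pint_cauchy_schwarz.
Qed.

(** * Piecewise polynomials *)

Lemma integrable_setU_disj d (T : measurableType d) (R : realType)
    (mu : {measure set T -> \bar R}) (A B : set T) (f : T -> \bar R) :
  measurable A -> measurable B -> [disjoint A & B]%classic ->
  mu.-integrable A f -> mu.-integrable B f -> mu.-integrable (A `|` B)%classic f.
Proof.
move=> mA mB AB /integrableP[mfA fA] /integrableP[mfB fB].
apply/integrableP; split; first exact/measurable_funU.
rewrite ge0_integral_setU//; last first.
  by apply/measurable_funU => //; split;
    exact: measurableT_comp.
exact: lte_add_pinfty.
Qed.

(** Half-open intervals let adjacent cells be glued disjointly; the unknown value of [f] at d sits
    on a null set. *)
Lemma integrable_Rintegral_eq_horner (R : realType) (c d : R) (f : R -> R)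
    (p : {poly R}) : c < d -> (forall y, c < y < d -> f y = p.[y]) ->
  lebesgue_measure.-integrable `]c, d]%classic (EFin \o f) /\
  (\int[lebesgue_measure]_(y in `]c, d]) f y)%R = pint c d p.
Proof.
move=> cd fp.
have fpE : {in `]c, d[%classic, horner p =1 f}.
  by move=> y; rewrite inE/= in_itv/= => /fp.
have ip := integrable_horner c d p.
have ipo : lebesgue_measure.-integrable `]c, d[%classic (EFin \o horner p).
  by apply: integrableS ip => //; exact: subset_itv_oo_cc.
have ifo : lebesgue_measure.-integrable `]c, d[%classic (EFin \o f).
  by apply: eq_integrable ipo => // y hy; rewrite /= fpE.
have ifc : lebesgue_measure.-integrable `]c, d]%classic (EFin \o f).
  have /integrableP[mf If] := ifo.
  apply/integrableP; split; first exact/emeasurable_fun_itv_bndo_bndcP.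
  by rewrite -integral_itv_bndo_bndc//; exact: measurableT_comp.
split=> //; rewrite -Rintegral_itv_bndo_bndc//.
transitivity (\int[lebesgue_measure]_(y in `]c, d[) p.[y])%R.
  by apply: eq_Rintegral => y hy; rewrite fpE.
rewrite Rintegral_itv_bndo_bndc//.
rewrite Rintegral_itv_obnd_cbnd ?Rintegral_horner//.
by apply: integrableS ip => //; exact: subset_itv_oc_cc.
Qed.

Definition pieces (R : realType) (N : nat) (x : nat -> R) (P : nat -> {poly R})
    (v : R -> R) : Prop :=
  forall j, (j < N)%N -> forall y, cell x j y -> v y = (P j).[y].

Lemma mesh_le (R : realType) (N : nat) (x : nat -> R) (m : nat) :
  (forall j, (j < N)%N -> x j < x j.+1) -> (m <= N)%N -> x 0%N <= x m.
Proof.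
move=> hx; elim: m => // m IH mN.
by apply: le_trans (IH (ltnW mN)) _; exact/ltW/hx.
Qed.

Lemma Rintegral_pieces (R : realType) (a b : R) (N : nat) (x : nat -> R)
    (f : R -> R) (P : nat -> {poly R}) :
  is_mesh a b N x -> pieces N x P f ->
  (\int[lebesgue_measure]_(y in `[a, b]) f y)%R =
  \sum_(j < N) pint (x j) (x j.+1) (P j).
Proof.
move=> [<- <- hx] fP.
(* Cells are glued from left to right; integrability is carried along because splitting the integral
   over a union requires it. *)
suff H m : (m <= N)%N ->
    lebesgue_measure.-integrable `]x 0%N, x m]%classic (EFin \o f) /\
    (\int[lebesgue_measure]_(y in `]x 0%N, x m]) f y)%R =
    \sum_(j < m) pint (x j) (x j.+1) (P j).
  have [i1 i2] := H N (leqnn N).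
  by rewrite -Rintegral_itv_obnd_cbnd.
elim: m => [_|m IH mN].
  rewrite set_itv_ge ?bnd_simp// big_ord0 Rintegral_set0.
  by split=> //; exact: integrable_set0.
have [i1 i2] := IH (ltnW mN).
have fPm y : x m < y < x m.+1 -> f y = (P m).[y].
  by move=> hy; apply: fP => //; rewrite /cell/= in_itv/=.
have [j1 j2] := integrable_Rintegral_eq_horner (hx m mN) fPm.
have U : `]x 0%N, x m.+1]%classic =
    (`]x 0%N, x m] `|` `]x m, x m.+1])%classic.
  apply: itv_bndbnd_setU; rewrite bnd_simp; first exact: mesh_le (ltnW mN).
  exact/ltW/hx.
have D : [disjoint `]x 0%N, x m]%classic & `]x m, x m.+1]%classic]%classic.
  apply/disj_setPS => y [] /=; rewrite !in_itv/= => /andP[_ h1] /andP[h2 _].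
  by move: (le_lt_trans h1 h2); rewrite ltxx.
have I : lebesgue_measure.-integrable
    (`]x 0%N, x m] `|` `]x m, x m.+1])%classic (EFin \o f).
  exact: integrable_setU_disj.
by rewrite U; split=> //; rewrite Rintegral_setU// i2 j2 big_ord_recr.
Qed.

(** Differentiation is local and cells are open, so near each point of a cell the function is its
    polynomial. *)
Lemma pieces_deriv (R : realType) (N : nat) (x : nat -> R) (P : nat -> {poly R})
    (v : R -> R) :
  pieces N x P v -> pieces N x (fun j => (P j)^`()) (derive1 v).
Proof.
move=> Pv j jN y yj; rewrite derivE !derive1E; apply: near_eq_derive.
have := near_in_itvoo yj; apply: filterS => z zj; exact: (Pv j jN z zj).
Qed.

Lemma pieces_mul (R : realType) (N : nat) (x : nat -> R) (P Q : nat -> {poly R})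
    (v w : R -> R) :
  pieces N x P v -> pieces N x Q w ->
  pieces N x (fun j => P j * Q j) (fun y => v y * w y).
Proof. by move=> Pv Qw j jN y yj; rewrite hornerM (Pv j jN y yj) (Qw j jN y yj). Qed.

Definition pcomb (R : realType) (s t : R) (P Q : nat -> {poly R}) : nat -> {poly R} :=
  fun j => s *: P j + t *: Q j.

Lemma pieces_comb (R : realType) (N : nat) (x : nat -> R) (s t : R)
    (P Q : nat -> {poly R}) (v w : R -> R) :
  pieces N x P v -> pieces N x Q w ->
  pieces N x (pcomb s t P Q) (fun y => s * v y + t * w y).
Proof.
by move=> Pv Qw j jN y yj; rewrite !hornerE (Pv j jN y yj) (Qw j jN y yj).
Qed.

Lemma Vh_pieces (R : realType) (N : nat) (x : nat -> R) (k : nat) (v : R -> R) :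
  Vh N x k v -> exists2 P : nat -> {poly R},
    forall j, (j < N)%N -> (size (P j) <= k.+1)%N & pieces N x P v.
Proof.
move=> hv.
have /choice[P hP] : forall j, exists p : {poly R}, (j < N)%N ->
    (size p <= k.+1)%N /\ forall y, cell x j y -> v y = p.[y].
  move=> j; case: (ltnP j N) => [/hv[p hp]|_]; first by exists p.
  by exists 0.
by exists P => j jN; have [] := hP j jN.
Qed.

Lemma pieces_Vh (R : realType) (N : nat) (x : nat -> R) (k : nat)
    (P : nat -> {poly R}) (v : R -> R) :
  (forall j, (j < N)%N -> (size (P j) <= k.+1)%N) -> pieces N x P v -> Vh N x k v.
Proof. by move=> sP Pv j jN; exists (P j); split; [exact: sP|exact: Pv]. Qed.

Lemma size_pcomb (R : realType) (N k : nat) (s t : R) (P Q : nat -> {poly R}) :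
  (forall j, (j < N)%N -> (size (P j) <= k)%N) ->
  (forall j, (j < N)%N -> (size (Q j) <= k)%N) ->
  forall j, (j < N)%N -> (size (pcomb s t P Q j) <= k)%N.
Proof.
move=> sP sQ j jN; rewrite (leq_trans (size_polyD _ _))// geq_max.
by rewrite !(leq_trans (size_scale_leq _ _)) ?sP ?sQ.
Qed.

(* The cell to the right of the node x_{j+1}, cells being numbered from 0. *)
Definition next_cell (N j : nat) : nat := if j.+1 == N then 0%N else j.+1.

Lemma next_cell_lt (N j : nat) : (j < N)%N -> (next_cell N j < N)%N.
Proof.
rewrite /next_cell; case: eqVneq => [<-//|jN] h.
by rewrite ltn_neqAle jN.
Qed.

(** The shift is cyclic, the last index giving the term of cell 0. Thanks to this periodicity, node
    sums can be regrouped by cells. *)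
Lemma sum_next_cell (R : nmodType) (N : nat) (F : nat -> R) :
  \sum_(j < N) F (next_cell N j) = \sum_(j < N) F j.
Proof.
case: N => [|N]; first by rewrite !big_ord0.
rewrite big_ord_recr [RHS]big_ord_recl /= {2}/next_cell eqxx addrC; congr (_ + _).
apply: eq_bigr => j _; rewrite /next_cell eqSS ltn_eqF ?ltn_ord//.
Qed.

Lemma trace_left_pieces (R : realType) (N : nat) (x : nat -> R)
    (P : nat -> {poly R}) (v : R -> R) (j : nat) :
  (forall j, (j < N)%N -> x j < x j.+1) -> pieces N x P v -> (j < N)%N ->
  trace_left x v j.+1 = (P j).[x j.+1].
Proof.
move=> hx Pv jN; apply: cvg_lim => //.
have h : ((P j).[y] @[y --> (x j.+1)^'-] --> (P j).[x j.+1])%classic.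
  by apply: cvg_at_left_filter; exact: continuous_horner.
apply: cvg_trans h; apply: near_eq_cvg; near=> y.
apply/esym/Pv => //; rewrite /cell/= in_itv/=; apply/andP; split; near: y.
  exact/nbhs_left_gt/hx.
exact: nbhs_left_lt.
Unshelve. all: by end_near. Qed.

Lemma trace_right_pieces (R : realType) (N : nat) (x : nat -> R)
    (P : nat -> {poly R}) (v : R -> R) (j : nat) :
  (forall j, (j < N)%N -> x j < x j.+1) -> pieces N x P v -> (j < N)%N ->
  trace_right N x v j.+1 = (P (next_cell N j)).[x (next_cell N j)].
Proof.
move=> hx Pv /next_cell_lt jN; apply: cvg_lim => //; rewrite -/(next_cell N j).
have h : ((P (next_cell N j)).[y] @[y --> (x (next_cell N j))^'+] -->
    (P (next_cell N j)).[x (next_cell N j)])%classic.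
  by apply: cvg_at_right_filter; exact: continuous_horner.
apply: cvg_trans h; apply: near_eq_cvg; near=> y.
apply/esym/Pv => //; rewrite /cell/= in_itv/=; apply/andP; split; near: y.
  exact: nbhs_right_gt.
exact/nbhs_right_lt/hx.
Unshelve. all: by end_near. Qed.

(** * Inner product and DG form in terms of polynomial pieces *)

Definition pinner (R : realType) (N : nat) (x : nat -> R) (P Q : nat -> {poly R}) : R :=
  \sum_(j < N) pint (x j) (x j.+1) (P j * Q j).

Definition paverage (R : realType) (N : nat) (x : nat -> R) (P : nat -> {poly R})
    (j : nat) : R :=
  ((P j).[x j.+1] + (P (next_cell N j)).[x (next_cell N j)]) / 2.

Definition pjump (R : realType) (N : nat) (x : nat -> R) (P : nat -> {poly R})
    (j : nat) : R :=
  (P (next_cell N j)).[x (next_cell N j)] - (P j).[x j.+1].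

Definition pform (R : realType) (N : nat) (x : nat -> R) (P Q : nat -> {poly R}) : R :=
  \sum_(j < N) pint (x j) (x j.+1) ((P j)^`() * (Q j)^`())
  + \sum_(j < N) (paverage N x (fun i => (P i)^`()) j * pjump N x Q j
                  + pjump N x P j * paverage N x (fun i => (Q i)^`()) j).

Lemma inner_pieces (R : realType) (a b : R) (N : nat) (x : nat -> R)
    (P Q : nat -> {poly R}) (v w : R -> R) :
  is_mesh a b N x -> pieces N x P v -> pieces N x Q w ->
  inner a b v w = pinner N x P Q.
Proof. by move=> hx Pv Qw; exact: (Rintegral_pieces hx (pieces_mul Pv Qw)). Qed.

Lemma dg_form_pieces (R : realType) (a b : R) (N : nat) (x : nat -> R)
    (P Q : nat -> {poly R}) (v w : R -> R) :
  is_mesh a b N x -> pieces N x P v -> pieces N x Q w ->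
  dg_form N x v w = pform N x P Q.
Proof.
move=> [_ _ hx] Pv Qw; have dP := pieces_deriv Pv; have dQ := pieces_deriv Qw.
congr (_ + _); apply: eq_bigr => -[j jN] _ /=; last first.
  rewrite /average /jump !(trace_left_pieces hx Pv, trace_left_pieces hx Qw)//.
  rewrite !(trace_left_pieces hx dP, trace_left_pieces hx dQ)//.
  rewrite !(trace_right_pieces hx Pv, trace_right_pieces hx Qw)//.
  by rewrite !(trace_right_pieces hx dP, trace_right_pieces hx dQ).
have h y : x j < y < x j.+1 ->
    derive1 v y * derive1 w y = ((P j)^`() * (Q j)^`()).[y].
  by move=> hy; apply: (pieces_mul dP dQ) => //; rewrite /cell/= in_itv/=.
have [i1 i2] := integrable_Rintegral_eq_horner (hx j jN) h.
rewrite /cell -i2 Rintegral_itv_bndo_bndc//.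
by apply: integrableS i1 => //; exact: subset_itv_oo_oc.
Qed.

(** * The DG form on piecewise polynomials *)

Lemma pinner_sym (R : realType) (N : nat) (x : nat -> R) (P Q : nat -> {poly R}) :
  pinner N x P Q = pinner N x Q P.
Proof. by apply: eq_bigr => j _; rewrite mulrC. Qed.

Lemma pinner_combl (R : realType) (N : nat) (x : nat -> R) (s t : R)
    (P P' Q : nat -> {poly R}) :
  pinner N x (pcomb s t P P') Q = s * pinner N x P Q + t * pinner N x P' Q.
Proof.
rewrite /pinner !mulr_sumr -big_split; apply: eq_bigr => j _ /=.
by rewrite mulrDl -!scalerAl pintD !pintZ.
Qed.

Lemma pinner_combr (R : realType) (N : nat) (x : nat -> R) (s t : R)
    (P Q Q' : nat -> {poly R}) :
  pinner N x P (pcomb s t Q Q') = s * pinner N x P Q + t * pinner N x P Q'.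
Proof. by rewrite pinner_sym pinner_combl !(pinner_sym _ _ P). Qed.

Lemma pinner_ge0 (R : realType) (N : nat) (x : nat -> R) (P : nat -> {poly R}) :
  (forall j, (j < N)%N -> x j < x j.+1) -> 0 <= pinner N x P P.
Proof. by move=> hx; apply: sumr_ge0 => j _; exact/pint_sqr_ge0/ltW/hx. Qed.

Lemma pform_sym (R : realType) (N : nat) (x : nat -> R) (P Q : nat -> {poly R}) :
  pform N x P Q = pform N x Q P.
Proof.
congr (_ + _); apply: eq_bigr => j _; first by rewrite mulrC.
by rewrite addrC [X in X + _]mulrC [X in _ + X]mulrC.
Qed.

Lemma pform_combl (R : realType) (N : nat) (x : nat -> R) (s t : R)
    (P P' Q : nat -> {poly R}) :
  pform N x (pcomb s t P P') Q = s * pform N x P Q + t * pform N x P' Q.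
Proof.
rewrite /pform !mulrDr addrACA; congr (_ + _).
all: rewrite !mulr_sumr -big_split; apply: eq_bigr => j _ /=.
  by rewrite derivD !derivZ mulrDl -!scalerAl pintD !pintZ.
rewrite /paverage /pjump /pcomb /= !derivD !derivZ !hornerD !hornerZ; ring.
Qed.

Lemma pform_combr (R : realType) (N : nat) (x : nat -> R) (s t : R)
    (P Q Q' : nat -> {poly R}) :
  pform N x P (pcomb s t Q Q') = s * pform N x P Q + t * pform N x P Q'.
Proof. by rewrite pform_sym pform_combl !(pform_sym _ _ P). Qed.

(** Weighted Young inequality at one node, with derivative traces [l1], [l2] and value traces [r1],
    [r2]; the weight [c] is left free for tuning. In terms of t = h / c it reads t |z| <= t^2 (l1^2
    + l2^2) + r1^2 + r2^2. *)
Lemma edge_term_le (R : realFieldType) (h c l1 l2 r1 r2 : R) : 0 < h -> 0 < c ->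
  h ^+ 2 * `|(l1 + l2) / 2 * (r2 - r1) + (r2 - r1) * ((l1 + l2) / 2)| <=
  (h ^+ 3 / c * l1 ^+ 2 + h * c * r1 ^+ 2) + (h ^+ 3 / c * l2 ^+ 2 + h * c * r2 ^+ 2).
Proof.
move=> h0 c0; set z := (X in `|X|); set t := h / c.
have hc : h = t * c by rewrite /t divfK ?gt_eqF.
have -> : h ^+ 3 / c = h * c * t ^+ 2 by rewrite /t; field; rewrite gt_eqF.
have t0 : 0 < t by exact: divr_gt0.
have zE : z = (l1 + l2) * (r2 - r1) by rewrite /z; field.
clearbody t z.
have -> : h ^+ 2 * `|z| = h * c * (t * `|z|).
  by transitivity (h * (t * c) * `|z|); [rewrite -hc|]; ring.
rewrite -(mulrA (h * c)) -(mulrA (h * c) (t ^+ 2) (l2 ^+ 2)) -!(mulrDr (h * c)).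
rewrite ler_pM2l ?mulr_gt0// -(gtr0_norm t0) -normrM (gtr0_norm t0).
rewrite ler_norml zE.
have : 0 <= (t * (l1 + l2) + (r2 - r1)) ^+ 2 by exact: sqr_ge0.
have : 0 <= (t * (l1 + l2) - (r2 - r1)) ^+ 2 by exact: sqr_ge0.
have : 0 <= (t * (l1 - l2)) ^+ 2 by exact: sqr_ge0.
have : 0 <= (r1 + r2) ^+ 2 by exact: sqr_ge0.
by move=> *; apply/andP; split; nra.
Qed.

(** The cell integrals contribute the first summand of gamma(k). The node terms, regrouped by cells,
    contribute half of the second summand for each of the two ends of a cell. *)
Lemma pform_quad_le (R : realType) (N : nat) (x : nat -> R) (k : nat) (h : R)
    (P : nat -> {poly R}) :
  0 < h -> (forall j, (j < N)%N -> h <= x j.+1 - x j) ->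
  (forall j, (j < N)%N -> (size (P j) <= k.+1)%N) ->
  h ^+ 2 * `|pform N x P P| <= dg_gamma R k * pinner N x P P.
Proof.
move=> h0 hh sP.
have hx j : (j < N)%N -> x j < x j.+1.
  by move=> /hh /(lt_le_trans h0); rewrite subr_gt0.
(* For degree 0 all derivatives, hence the form, vanish; otherwise K > 0 permits division by the
   weight [c]. *)
case: k sP => [|k] sP.
  have dP j : (j < N)%N -> (P j)^`() = 0.
    by move=> /sP sj; rewrite (size1_polyC sj) derivC.
  rewrite /dg_gamma !(mulr0, mul0r) addr0 mul0r /pform big1; last first.
    by move=> [j jN] _ /=; rewrite dP// mul0r pint0.
  rewrite big1 ?addr0 ?normr0 ?mulr0// => -[j jN] _ /=.
  by rewrite /paverage !dP ?next_cell_lt// !horner0 addr0 !(mul0r, mulr0) addr0.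
set K : R := k.+1%:R.
have K0 : 0 < K by rewrite ltr0n.
set s := Num.sqrt (K * (K + 2)).
have s0 : 0 < s by rewrite sqrtr_gt0 mulr_gt0// addr_gt0.
have s2 : s ^+ 2 = K * (K + 2) by rewrite sqr_sqrtr// ltW// mulr_gt0// addr_gt0.
(* This weight makes the derivative and value parts of [trace_le] equal. *)
set c := K * s; have c0 : 0 < c by exact: mulr_gt0.
(* [F] and [G] are the shares of cell j in the Young bounds at its right and left end. *)
pose F j := h ^+ 3 / c * ((P j)^`()).[x j.+1] ^+ 2 + h * c * (P j).[x j.+1] ^+ 2.
pose G j := h ^+ 3 / c * ((P j)^`()).[x j] ^+ 2 + h * c * (P j).[x j] ^+ 2.
pose A j := pint (x j) (x j.+1) ((P j)^`() * (P j)^`()).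
pose B j := pint (x j) (x j.+1) (P j * P j).
have A0 j : (j < N)%N -> 0 <= A j by move=> /hx/ltW; exact: pint_sqr_ge0.
have AB j : (j < N)%N -> h ^+ 2 * A j <= (K + 1) ^+ 2 * s ^+ 2 * B j.
  move=> jN; have := poly_markov_L2 (hx j jN) (sP j jN); rewrite -/K -/(A j) -/(B j).
  have -> : (K + 1) ^+ 2 * s ^+ 2 = K * (K + 1) ^+ 2 * (K + 2) by rewrite s2; ring.
  apply: le_trans; rewrite ler_wpM2r ?A0// ler_pXn2r ?nnegrE ?(ltW h0) ?hh//.
  by rewrite subr_ge0 ltW ?hx.
have trace_le j y : (j < N)%N -> y = x j \/ y = x j.+1 ->
    h ^+ 3 / c * ((P j)^`()).[y] ^+ 2 + h * c * (P j).[y] ^+ 2 <=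
    2 * (K + 1) ^+ 2 * c * B j.
  move=> jN hy.
  have hz z : 0 <= z -> h * z <= (x j.+1 - x j) * z.
    by move=> z0; rewrite ler_wpM2r// hh.
  have t1 : h * (P j).[y] ^+ 2 <= (K + 1) ^+ 2 * B j.
    apply: le_trans (hz _ (sqr_ge0 _)) _; rewrite natr1.
    have [h1 h2] := poly_trace_ineq (hx j jN) (sP j jN).
    by case: hy => ->.
  (* The derivative has one degree less, whence K in place of K + 1. *)
  have t2 : h * ((P j)^`()).[y] ^+ 2 <= K ^+ 2 * A j.
    apply: le_trans (hz _ (sqr_ge0 _)) _.
    have sd : (size (P j)^`() <= k.+1)%N.
      apply/leq_sizeP => i ki; rewrite coef_deriv nth_default ?mul0rn//.
      by rewrite (leq_trans (sP j jN)).
    have [h1 h2] := poly_trace_ineq (hx j jN) sd.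
    by case: hy => ->.
  have t3 : h ^+ 3 / c * ((P j)^`()).[y] ^+ 2 <= (K + 1) ^+ 2 * c * B j.
    have -> : h ^+ 3 / c * ((P j)^`()).[y] ^+ 2 =
        h ^+ 2 / c * (h * ((P j)^`()).[y] ^+ 2) by field; rewrite gt_eqF.
    apply: (@le_trans _ _ (h ^+ 2 / c * (K ^+ 2 * A j))).
      by rewrite ler_wpM2l// divr_ge0 ?sqr_ge0 ?ltW.
    have -> : h ^+ 2 / c * (K ^+ 2 * A j) = K ^+ 2 / c * (h ^+ 2 * A j).
      by field; rewrite gt_eqF.
    have -> : (K + 1) ^+ 2 * c * B j = K ^+ 2 / c * ((K + 1) ^+ 2 * s ^+ 2 * B j).
      by rewrite /c; field; rewrite !gt_eqF.
    by rewrite ler_wpM2l ?AB// divr_ge0 ?sqr_ge0 ?ltW.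
  have t4 : h * c * (P j).[y] ^+ 2 <= (K + 1) ^+ 2 * c * B j.
    have -> : h * c * (P j).[y] ^+ 2 = c * (h * (P j).[y] ^+ 2) by ring.
    have -> : (K + 1) ^+ 2 * c * B j = c * ((K + 1) ^+ 2 * B j) by ring.
    by rewrite ler_wpM2l// ltW.
  lra.
have -> : dg_gamma R k.+1 * pinner N x P P =
    \sum_(j < N) (K + 1) ^+ 2 * s ^+ 2 * B j +
    (\sum_(j < N) 2 * (K + 1) ^+ 2 * c * B j +
     \sum_(j < N) 2 * (K + 1) ^+ 2 * c * B j).
  rewrite -!mulr_sumr /pinner -/(B _) s2 /dg_gamma -/K -/s /c; ring.
rewrite /pform; apply: (@le_trans _ _
  (h ^+ 2 * (\sum_(j < N) A j + \sum_(j < N)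
     `|paverage N x (fun i => (P i)^`()) j * pjump N x P j
       + pjump N x P j * paverage N x (fun i => (P i)^`()) j|))).
  rewrite ler_wpM2l ?sqr_ge0//; apply: le_trans (ler_normD _ _) _.
  apply: lerD; last exact: ler_norm_sum.
  by rewrite ger0_norm// sumr_ge0// => -[j jN] _; exact: A0.
rewrite mulrDr; apply: lerD.
  by rewrite mulr_sumr; apply: ler_sum => -[j jN] _; exact: AB.
apply: (@le_trans _ _ (\sum_(j < N) (F j + G (next_cell N j)))).
  by rewrite mulr_sumr; apply: ler_sum => -[j jN] _; exact: edge_term_le.
rewrite big_split/= sum_next_cell; apply: lerD; apply: ler_sum => -[j jN] _.
- by apply: trace_le => //; right.
- by apply: trace_le => //; left.
Qed.

(** Polarization writes 4 s A(P, Q) as the difference of the quadratic form at sP + Q and sP - Q;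
    the parallelogram law adds up the two norms. The parameter [s] serves as a Young weight. *)
Lemma pform_polarized_le (R : realType) (N : nat) (x : nat -> R) (k : nat) (h s : R)
    (P Q : nat -> {poly R}) :
  0 < h -> (forall j, (j < N)%N -> h <= x j.+1 - x j) ->
  (forall j, (j < N)%N -> (size (P j) <= k.+1)%N) ->
  (forall j, (j < N)%N -> (size (Q j) <= k.+1)%N) ->
  - (2 * s * h ^+ 2 * pform N x P Q) <=
  dg_gamma R k * (s ^+ 2 * pinner N x P P + pinner N x Q Q).
Proof.
move=> h0 hh sP sQ.
have h2 : 0 <= h ^+ 2 by exact: sqr_ge0.
have := pform_quad_le h0 hh (size_pcomb s 1 sP sQ).
have := pform_quad_le h0 hh (size_pcomb s (-1) sP sQ).
move/(le_trans (ler_wpM2l h2 (ler_norm _))) => H1.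
rewrite -normrN => /(le_trans (ler_wpM2l h2 (ler_norm _))) H2.
move: H1 H2; rewrite !(pform_combl, pform_combr, pinner_combl, pinner_combr).
rewrite !(pform_sym _ _ Q P) !(pinner_sym _ _ Q P); nra.
Qed.

(** * Energy argument and stability *)

Lemma hmin_gt0 (R : realType) (a b : R) (N : nat) (x : nat -> R) :
  a < b -> is_mesh a b N x -> 0 < hmin a b N x.
Proof.
move=> ab [_ _ hx]; rewrite /hmin.
by elim/big_ind: _ => [|u v u0 v0|j _]; rewrite ?subr_gt0 ?lt_min ?u0 ?v0 ?hx.
Qed.

Lemma hmin_le (R : realType) (a b : R) (N : nat) (x : nat -> R) (j : nat) :
  (j < N)%N -> hmin a b N x <= x j.+1 - x j.
Proof.
by move=> jN; apply: (bigmin_le (b - a) (Ordinal jN) (fun i : 'I_N => x i.+1 - x i)).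
Qed.

Lemma norm2_sqr (R : realType) (a b : R) (f : R -> R) :
  norm2 a b f ^+ 2 = inner a b f f.
Proof.
rewrite sqr_sqrtr//; apply: Rintegral_ge0 => y _; rewrite -expr2; exact: sqr_ge0.
Qed.

(* [D] stands for |u^{n+1} - u^n|^2. *)
Lemma dg_scheme_step (R : realType) (a b : R) (N : nat) (x : nat -> R) (k : nat)
    (theta dt : R) (u q : nat -> R -> R) (n : nat) :
  a < b -> is_mesh a b N x -> 0 < dt -> dg_scheme a b N x k theta dt u q ->
  exists D W : R,
  [/\ 0 <= W, W = norm2 a b (theta_avg theta (q n) (q n.+1)) ^+ 2, 0 <= D,
      norm2 a b (u n.+1) ^+ 2 - norm2 a b (u n) ^+ 2 + (2 * theta - 1) * D =
      - (2 * dt * W)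
    & hmin a b N x ^+ 4 * D <= (dt * dg_gamma R k) ^+ 2 * W].
Proof.
move=> ab hmesh dt0 hs; have [_ _ hx] := hmesh.
have [/Vh_pieces[U0 sU0 pU0] /Vh_pieces[Q0 sQ0 pQ0] E1 E20] := hs n.
have [/Vh_pieces[U1 sU1 pU1] /Vh_pieces[Q1 sQ1 pQ1] _ E21] := hs n.+1.
(* [W], [U] and [D] hold the pieces of q^{n+theta}, u^{n+theta} and u^{n+1} - u^n. *)
pose W := pcomb (1 - theta) theta Q0 Q1.
pose U := pcomb (1 - theta) theta U0 U1.
pose D := pcomb 1 (-1) U1 U0.
have pW : pieces N x W (theta_avg theta (q n) (q n.+1)) by exact: pieces_comb.
have pD := pieces_comb 1 (-1) pU1 pU0.
have pU := pieces_comb (1 - theta) theta pU0 pU1.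
have sW : forall j, (j < N)%N -> (size (W j) <= k.+1)%N by exact: size_pcomb.
have sU : forall j, (j < N)%N -> (size (U j) <= k.+1)%N by exact: size_pcomb.
have sD : forall j, (j < N)%N -> (size (D j) <= k.+1)%N by exact: size_pcomb.
have test1 (V : nat -> {poly R}) v : (forall j, (j < N)%N -> (size (V j) <= k.+1)%N) ->
    pieces N x V v -> pinner N x D V = - (dt * pform N x W V).
  move=> sV pV; have := E1 v (pieces_Vh sV pV).
  have -> : (fun y => (u n.+1 y - u n y) / dt) =
      (fun y => dt^-1 * u n.+1 y + (- dt^-1) * u n y).
    by apply/funext => y; rewrite mulrBl mulNr ![_ / dt]mulrC.
  rewrite (inner_pieces hmesh (pieces_comb dt^-1 (- dt^-1) pU1 pU0) pV).
  rewrite (dg_form_pieces hmesh pW pV) !pinner_combl => h.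
  rewrite -mulrN -h mulrDr !mulrA mulrN mulfV ?gt_eqF//.
have test2 : pinner N x W W = pform N x U W.
  have := E20 _ (pieces_Vh sW pW); have := E21 _ (pieces_Vh sW pW).
  rewrite (inner_pieces hmesh pQ0 pW) (inner_pieces hmesh pQ1 pW).
  rewrite (dg_form_pieces hmesh pU0 pW) (dg_form_pieces hmesh pU1 pW) => h1 h0.
  by rewrite pinner_combl pform_combl h0 h1.
have W0 := pinner_ge0 W hx; have D0 := pinner_ge0 D hx.
exists (pinner N x D D), (pinner N x W W).
rewrite !norm2_sqr (inner_pieces hmesh pW pW).
rewrite (inner_pieces hmesh pU0 pU0) (inner_pieces hmesh pU1 pU1).
split=> //.
  have := test1 U _ sU pU; rewrite pform_sym -test2 => e.
  (* As U = (1 - theta) U0 + theta U1, expanding 2 (D, U) gives |U1|^2 - |U0|^2 + (2 theta - 1)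
     |D|^2. *)
  transitivity (2 * pinner N x D U); last by rewrite e; ring.
  rewrite !(pinner_combl, pinner_combr) (pinner_sym _ _ U1 U0); ring.
have eD := test1 D _ sD pD.
have h0 := hmin_gt0 ab hmesh; set h := hmin a b N x in h0 *.
have pol t := pform_polarized_le t h0 (@hmin_le _ a b N x) sW sD.
set g := dg_gamma R k in pol *; set DD := pinner N x D D in eD pol D0 *.
set WW := pinner N x W W in pol W0 *; set f := pform N x W D in eD pol.
have h2 : 0 < h ^+ 2 by rewrite exprn_gt0.
have g0 : 0 <= g.
  by rewrite /g /dg_gamma addr_ge0// !mulr_ge0 ?addr_ge0 ?sqr_ge0 ?sqrtr_ge0.
(* The Young weight [dt * g / h ^+ 2], used below, absorbs half of [DD]. *)
move: g0; rewrite le_eqVlt => /predU1P[g0|g0].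
  (* If gamma vanishes, as for k = 0, it cannot be cancelled; the bound with weight 1 then already
     gives |D|^2 <= 0. *)
  have := pol 1; rewrite -g0 mul0r mulr0 expr0n/= mul0r => p1.
  have : h ^+ 2 * DD <= 0 by rewrite eD; nra.
  rewrite pmulr_rle0// => D1; rewrite -[4%N]/(2 + 2)%N exprD -mulrA.
  by rewrite !pmulr_rle0.
have := pol (dt * g / h ^+ 2).
have -> : 2 * (dt * g / h ^+ 2) * h ^+ 2 * f = - (2 * g * DD).
  by rewrite eD; field; rewrite gt_eqF.
rewrite opprK mulrC -[2 * g]mulrC => p1.
have : 2 * DD <= (dt * g / h ^+ 2) ^+ 2 * WW + DD.
  by rewrite -(ler_pM2l g0); move: p1; nra.
have -> : (dt * g / h ^+ 2) ^+ 2 = (dt * g) ^+ 2 / h ^+ 4.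
  by field; rewrite gt_eqF.
move=> p2; have : DD <= (dt * g) ^+ 2 / h ^+ 4 * WW by lra.
by rewrite mulrAC ler_pdivlMr ?exprn_gt0// mulrC.
Qed.

Theorem theorem2p3 (R : realType) (a b : R) (N : nat) (x : nat -> R) (k : nat)
    (theta dt : R) (u q : nat -> R -> R)
    (hab : a < b)
    (hmesh : is_mesh a b N x)
    (htheta : 0 <= theta <= 1)
    (hdt : 0 < dt)
    (hscheme : dg_scheme a b N x k theta dt u q) :
  (1 / 2 <= theta ->
     L2_stable a b u /\
     forall n : nat,
       norm2 a b (u n.+1) ^+ 2 <=
         norm2 a b (u n) ^+ 2
         - 2 * dt * norm2 a b (theta_avg theta (q n) (q n.+1)) ^+ 2)
  /\
  (theta < 1 / 2 ->
     time_step_restriction (hmin a b N x) theta dt k ->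
     L2_stable a b u).
Proof.
have norm2_le f g : norm2 a b f ^+ 2 <= norm2 a b g ^+ 2 -> norm2 a b f <= norm2 a b g.
  by rewrite ler_pXn2r// nnegrE sqrtr_ge0.
split=> [ht|ht hr].
  have H n : norm2 a b (u n.+1) ^+ 2 <= norm2 a b (u n) ^+ 2
      - 2 * dt * norm2 a b (theta_avg theta (q n) (q n.+1)) ^+ 2.
    have [D [W [W0 <- D0 e _]]] := dg_scheme_step n hab hmesh hdt hscheme.
    have : 0 <= (2 * theta - 1) * D by rewrite mulr_ge0//; lra.
    lra.
  split=> // n; apply: norm2_le; apply: le_trans (H n) _.
  by rewrite gerBl mulr_ge0 ?sqr_ge0// mulr_ge0// ltW.
move=> n; apply: norm2_le.
have [D [W [W0 _ D0 e eD]]] := dg_scheme_step n hab hmesh hdt hscheme.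
have h0 : 0 < hmin a b N x ^+ 4 by rewrite exprn_gt0// hmin_gt0.
suff : (1 - 2 * theta) * D <= 2 * dt * W by lra.
rewrite -(ler_pM2l h0).
(* The bound on h^4 D, multiplied by 1 - 2 theta, is arranged to exhibit the left side of the
   time-step restriction as a factor. *)
apply: (@le_trans _ _ (dt * W * (dt * ((1 - 2 * theta) * dg_gamma R k ^+ 2)))).
  have t0 : 0 <= 1 - 2 * theta by lra.
  by move: (ler_wpM2l t0 eD); lra.
apply: (@le_trans _ _ (dt * W * (2 * hmin a b N x ^+ 4))); last by lra.
by rewrite ler_wpM2l ?(ltW hr)// mulr_ge0// ltW.
Qed.
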